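(* Let $q\ge1$, $p<p_c(q)=\frac{\sqrt q}{\sqrt q+1}$, and let $\eta$ be a side-homogeneous boundary condition on $\Lambda_n$. Then the mixing time of the discrete-time Glauber dynamics on $\Lambda_n$ with boundary condition $\eta$ is $\Omega(n^2\log n)$, i.e., at least $c\,n^2\log n$ for a constant $c>0$ depending only on $p,q$ and all sufficiently large $n$.
   Context: $\Lambda_n=(\Lambda_n,E_n)$ is the $n\times n$ box of $\mathbb Z^2$ with nearest-neighbor edges; $\partial\Lambda_n$ its set of vertices with a $\mathbb Z^2$-neighbor outside. A boundary condition $\eta$ is a partition of $\partial\Lambda_n$; $\mu^\eta_{\Lambda_n,p,q}(A)\propto p^{|A|}(1-p)^{|E_n\setminus A|}q^{c(A,\eta)}$, where $c(A,\eta)$ counts components of $(\Lambda_n,A)$ with components containing vertices of a common block of $\eta$ identified. With $L_1,\dots,L_4$ the vertex sets of the four sides, $\eta$ is side-homogeneous if (P1) at most one block has more than one element and (P2) such a block is a union of some of the $L_j$. The Glauber dynamics picks $e\in E_n$ uniformly at random and sets $e$ open with probability $\frac{\mu^\eta(A\cup\{e\})}{\mu^\eta(A\cup\{e\})+\mu^\eta(A\setminus\{e\})}$, closed otherwise. Mixing time: $\tau_{\rm mix}=\max_{X_0}\min\{t:\|\mathcal M^t(X_0,\cdot)-\mu^\eta\|_{TV}\le1/4\}$. *)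

(* Defs.v *)
From Stdlib Require Import Reals.
From HB Require Import structures.
From mathcomp Require Import all_boot.

Set Implicit Arguments.
Unset Strict Implicit.
Unset Printing Implicit Defensive.

Notation V n := ('I_n * 'I_n)%type.

Definition adj (n : nat) (u v : V n) : bool :=
  ((val u.1 == val v.1) && (val v.2 == (val u.2).+1)) ||
  ((val u.2 == val v.2) && (val v.1 == (val u.1).+1)).

(* Edge set E_n: each nearest-neighbour edge represented once, as an oriented pair. *)
Definition E (n : nat) : {set V n * V n} := [set e | adj e.1 e.2].

Definition side (n : nat) (j : 'I_4) : {set V n} :=
  [set v : V n | match val j with
                 | 0 => val v.1 == 0
                 | 1 => val v.1 == n.-1
                 | 2 => val v.2 == 0
                 | _ => val v.2 == n.-1
                 end].

(* Boundary: vertices with a Z^2-neighbour outside the box = union of the sides. *)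
Definition bnd (n : nat) : {set V n} := \bigcup_(j : 'I_4) side n j.

Definition boundary_condition (n : nat) (eta : {set {set V n}}) : Prop :=
  partition eta (bnd n).

Definition side_homogeneous (n : nat) (eta : {set {set V n}}) : Prop :=
  boundary_condition eta /\
  (forall B1 B2, B1 \in eta -> B2 \in eta -> 1 < #|B1| -> 1 < #|B2| -> B1 = B2) /\
  (forall B, B \in eta -> 1 < #|B| ->
     exists S : {set 'I_4}, B = \bigcup_(j in S) side n j).

(* Connectivity relation of (Lambda_n, A) with vertices of a common block of eta identified. *)
Definition clrel (n : nat) (A : {set V n * V n}) (eta : {set {set V n}}) : rel (V n) :=
  fun x y => [|| (x, y) \in A, (y, x) \in A | [exists B in eta, (x \in B) && (y \in B)]].

Definition ncomp (n : nat) (A : {set V n * V n}) (eta : {set {set V n}}) : nat :=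
  n_comp (clrel A eta) predT.

Local Open Scope R_scope.

Definition rc_weight (n : nat) (p q : R) (eta : {set {set V n}}) (A : {set V n * V n}) : R :=
  p ^ #|A| * (1 - p) ^ (#|E n| - #|A|)%nat * q ^ ncomp A eta.

Definition rc_Z (n : nat) (p q : R) (eta : {set {set V n}}) : R :=
  \big[Rplus/0]_(A in powerset (E n)) rc_weight p q eta A.

Definition rc_mu (n : nat) (p q : R) (eta : {set {set V n}}) (A : {set V n * V n}) : R :=
  rc_weight p q eta A / rc_Z p q eta.

Definition open_prob (n : nat) (p q : R) (eta : {set {set V n}})
    (A : {set V n * V n}) (e : V n * V n) : R :=
  rc_mu p q eta (A :|: [set e]) /
  (rc_mu p q eta (A :|: [set e]) + rc_mu p q eta (A :\ e)).

Definition glauber (n : nat) (p q : R) (eta : {set {set V n}})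
    (A B : {set V n * V n}) : R :=
  / INR #|E n| *
  \big[Rplus/0]_(e in E n)
     ((if B == A :|: [set e] then open_prob p q eta A e else 0) +
      (if B == A :\ e then 1 - open_prob p q eta A e else 0)).

Fixpoint distr (n : nat) (p q : R) (eta : {set {set V n}})
    (X0 : {set V n * V n}) (t : nat) : {set V n * V n} -> R :=
  match t with
  | O => fun B => if B == X0 then 1 else 0
  | S t' => fun B => \big[Rplus/0]_(A in powerset (E n))
                       (distr p q eta X0 t' A * glauber p q eta A B)
  end.

Definition tv (n : nat) (f g : {set V n * V n} -> R) : R :=
  / 2 * \big[Rplus/0]_(A in powerset (E n)) Rabs (f A - g A).

(* tau_mix >= T, with tau_mix = max_{X0} min {t : ||M^t(X0,.) - mu||_TV <= 1/4}
   (literal unfolding: some X0 such that every t < T has TV distance > 1/4). *)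
Definition tau_mix_ge (n : nat) (p q : R) (eta : {set {set V n}}) (T : R) : Prop :=
  exists X0 : {set V n * V n}, X0 \subset E n /\
    forall t : nat, INR t < T -> tv (distr p q eta X0 t) (rc_mu p q eta) > / 4.

(* Main.v *)
(* Let f(A) = |A| and let m be the number of edges.  Assume that from every initial
   state the chain is within distance 1/4 of mu before time T = c m log m.

   Variance.  The heat-bath operator is positive and self-adjoint, so the stationary
   autocorrelations of f are convex in time and drop by at most 1 per step, while
   mixing halves oscillations every T steps; hence Var_mu f <= kT + m^2 / 2^k for all
   k, which is m^(1 + o(1)) for k of order log m.

   Shift.  Since q >= 1 the dynamics is monotone.  Couple the chain X started from the
   full configuration with a stationary chain Y below it, using the same edge updates.
   The edges closed in Y_0 and not updated by time T are open in X_T and closed in Y_T,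
   so f(X_T) >= f(Y_T) + W_T with W_T their number, which is concentrated around a
   value of order m^(1 - 2c).  This exceeds the fluctuations of f(Y_T), so X_T is far
   from stationarity at time T, a contradiction.

   Distributions are handled through their dual action on test functions: [average]
   is the Markov operator that draws a uniform element of D and applies the
   corresponding update, and its iterates give expectations at time t. *)
Require Import Defs.
From Stdlib Require Import Reals Lra Lia.
From HB Require Import structures.
From mathcomp Require Import all_boot.

Set Implicit Arguments.
Unset Strict Implicit.
Unset Printing Implicit Defensive.

(** * Elementary estimates for the window, the number of rounds and the survival rate *)

Section Asymptotics.

Local Open Scope R_scope.

Lemma exp_le_compat (x y : R) : x <= y -> exp x <= exp y.
Proof. by case=> [lt|->]; [left; apply exp_increasing | right]. Qed.

Lemma ln_le_compat (x y : R) : 0 < x -> x <= y -> ln x <= ln y.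
Proof. by move=> x0 [lt|->]; [left; apply ln_increasing | right]. Qed.

(** Follows from [1 + 2x <= exp (2x)] and [(1 - x)(1 + 2x) = 1 + x(1 - 2x) >= 1] on this range. *)
Lemma exp_neg_le (x : R) : 0 <= x -> x <= / 2 -> exp (- (2 * x)) <= 1 - x.
Proof.
intros x0 x2; rewrite exp_Ropp.
assert (1 + 2 * x <= exp (2 * x)) by apply exp_ineq1_le.
apply Rmult_le_reg_l with (exp (2 * x)); first apply exp_pos.
rewrite Rinv_r; nra.
Qed.

Lemma nat_ceiling (x : R) : 0 <= x -> exists T : nat, x <= INR T <= x + 1.
Proof.
intros x0; destruct (archimed x) as [up1 up2].
exists (Z.to_nat (up x)); rewrite INR_IZR_INZ Znat.Z2Nat.id; first lra.
apply le_IZR; lra.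
Qed.

(* With L = m^(1/8): the standard deviation is O(L^5), the window is s = L^6, and
   at least a multiple of L^7 edges survive. *)
Lemma window_exists (p : R) : 0 < p -> p < 1 -> exists M : R, 4 <= M /\
  forall m T : nat, M <= INR m -> INR T <= / 16 * (INR m * ln (INR m)) + 1 ->
  exists (k : nat) (s : R), 0 < s /\
    4 * s <= ((1 - p) * INR m - s) * (1 - / INR m) ^ T /\
    3 * ((INR k * INR T + INR m ^ 2 / 2 ^ k) / s ^ 2) + / s < 3 / 4.
Proof.
(* For [L >= L0] this gives [(1 - p) L >= 24], enough for [12 L <= (1 - p) L^2 - 1]; the final
   numerical estimate uses [L >= 24]. *)
intros p0 p1; pose (L0 := 24 / (1 - p)).
assert (L0_ge : 24 <= L0).
{ unfold L0; apply Rmult_le_reg_r with (1 - p); first lra.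
  unfold Rdiv; rewrite Rmult_assoc Rinv_l; lra. }
assert (L0p : (1 - p) * L0 = 24) by (unfold L0; field; lra).
exists (L0 ^ 8); split.
{ assert (L0 ^ 1 <= L0 ^ 8) by (apply Rle_pow; [lra | lia]); lra. }
intros m T le_m le_T.
assert (L08 : 0 < L0 ^ 8) by (apply pow_lt; lra).
assert (m0 : 0 < INR m) by lra.
pose (L := exp (ln (INR m) / 8)).
assert (L_pos : 0 < L) by apply exp_pos.
assert (mL : INR m = L ^ 8).
{ rewrite -[L ^ 8]exp_ln; last by apply pow_lt.
  rewrite ln_pow // /L ln_exp -[LHS]exp_ln //; f_equal; simpl; field. }
assert (L_ge : L0 <= L).
{ rewrite -[L0]exp_ln; last lra.
  apply exp_le_compat.
  assert (ln (L0 ^ 8) <= ln (INR m)) by (apply ln_le_compat; lra).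
  rewrite ln_pow in H; [simpl in H; lra | lra]. }
assert (ln_m : ln (INR m) = 8 * ln L) by (rewrite mL ln_pow //; simpl; ring).
assert (ln_L : 0 <= ln L <= L).
{ split; first by (rewrite -ln_1; apply ln_le_compat; lra).
  assert (H := exp_ineq1_le (ln L)); rewrite exp_ln in H; lra. }
(* Since [2 ln 2 > 1], this many rounds give [2^k >= m], hence [m^2 / 2^k <= m]. *)
destruct (@nat_ceiling (2 * ln (INR m))) as [k [k1 k2]]; first lra.
exists k, (L ^ 6).
assert (L6 : 0 < L ^ 6) by (apply pow_lt; lra).
assert (L8 : 0 < L ^ 8) by (apply pow_lt; lra).
assert (L8_ge : 4 <= L ^ 8).
{ assert (L ^ 1 <= L ^ 8) by (apply Rle_pow; [lra | lia]); lra. }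
split; [exact L6 | split].
(* [(1 - 1/m)^T >= exp (-2T/m)], where [T <= m ln L / 2 + 1] bounds [2T/m] by [ln L + 1]; then
   [exp 1 <= 3]. *)
- assert (surv : / L * / 3 <= (1 - / INR m) ^ T).
  { apply Rle_trans with (exp (- (2 * / INR m)) ^ T).
    + rewrite -[_ ^ T]exp_ln; last by apply pow_lt, exp_pos.
      rewrite ln_pow; last by apply exp_pos.
      rewrite ln_exp.
      apply Rle_trans with (exp (- ln L + - (1))).
      * rewrite exp_plus !exp_Ropp exp_ln //.
        apply Rmult_le_compat_l; first by apply Rlt_le, Rinv_0_lt_compat.
        apply Rinv_le_contravar; [apply exp_pos | apply exp_le_3].
      * apply exp_le_compat.
        assert (INR T * (2 * / INR m) <= ln L + 1); last lra.
        apply Rmult_le_reg_r with (INR m); first exact m0.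
        rewrite !Rmult_assoc Rinv_l; last lra.
        rewrite ln_m mL in le_T *; nra.
    + apply pow_incr; split; first by apply Rlt_le, exp_pos.
      apply exp_neg_le; first by apply Rlt_le, Rinv_0_lt_compat.
      apply Rinv_le_contravar; lra. }
  apply Rle_trans with (((1 - p) * INR m - L ^ 6) * (/ L * / 3)).
  + rewrite mL.
    apply Rmult_le_reg_r with (3 * L); first lra.
    replace (((1 - p) * L ^ 8 - L ^ 6) * (/ L * / 3) * (3 * L))
      with (((1 - p) * L ^ 2 - 1) * L ^ 6) by (field; lra).
    replace (4 * L ^ 6 * (3 * L)) with (12 * L * L ^ 6) by ring.
    apply Rmult_le_compat_r; first lra.
    assert (24 <= (1 - p) * L) by nra.
    simpl; nra.
  + apply Rmult_le_compat_l; last exact surv.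
    rewrite mL; replace (L ^ 8) with (L ^ 2 * L ^ 6) by ring.
    assert (24 <= (1 - p) * L) by nra.
    assert (1 <= (1 - p) * L ^ 2) by (simpl; nra).
    nra.
- assert (pow_k : INR m <= 2 ^ k).
  { rewrite -[2 ^ k]exp_ln; last by (apply pow_lt; lra).
    rewrite ln_pow; last lra.
    rewrite -[X in X <= _]exp_ln //; apply exp_le_compat.
    assert (H := ln_lt_2); nra. }
  assert (v1 : INR m ^ 2 / 2 ^ k <= L ^ 8).
  { apply Rmult_le_reg_r with (2 ^ k); first lra.
    unfold Rdiv; rewrite Rmult_assoc Rinv_l; last lra.
    rewrite -mL; simpl; nra. }
  (* [k <= 2 ln m + 1 = 16 ln L + 1] and [ln L <= L]. The crude bound is affordable: [k T] is at
     most of order [L^10], against [s^2 = L^12]. *)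
  assert (kL : INR k <= 17 * L) by lra.
  assert (TL : INR T <= L ^ 9).
  { rewrite ln_m mL in le_T; replace (L ^ 9) with (L ^ 8 * L) by ring; nra. }
  assert (v2 : INR k * INR T <= 17 * L ^ 10).
  { replace (17 * L ^ 10) with (17 * L * L ^ 9) by ring.
    apply Rmult_le_compat; auto using pos_INR. }
  assert (v3 : L ^ 8 <= L ^ 10) by (apply Rle_pow; [lra | lia]).
  assert (v4 : (INR k * INR T + INR m ^ 2 / 2 ^ k) / (L ^ 6) ^ 2 <= 18 / L ^ 2).
  { replace (18 / L ^ 2) with (18 * L ^ 10 / (L ^ 6) ^ 2) by (field; lra).
    apply Rmult_le_compat_r; last lra.
    apply Rlt_le, Rinv_0_lt_compat, pow_lt; lra. }
  assert (i1 : / L <= / 24) by (apply Rinv_le_contravar; lra).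
  assert (i0 : 0 < / L) by (apply Rinv_0_lt_compat; lra).
  assert (i2 : 18 / L ^ 2 <= / 32).
  { replace (18 / L ^ 2) with (18 * (/ L * / L)) by (field; lra); nra. }
  assert (i3 : / L ^ 6 <= / L).
  { apply Rinv_le_contravar; first lra.
    assert (L ^ 1 <= L ^ 6) by (apply Rle_pow; [lra | lia]); lra. }
  lra.
Qed.

End Asymptotics.

From mathcomp Require Import all_order all_algebra boolp Rstruct ring lra.

Import Order.TTheory GRing.Theory Num.Theory.

(** The closure of [{x, y}] is one component once the edge is added, and one or two before; outside
    it both relations have the same components. *)
Lemma n_comp_add_edge (T : finType) (e e' : rel T) (x y : T) :
  symmetric e ->
  e' =2 (fun u v => [|| e u v, (u == x) && (v == y) | (u == y) && (v == x)]) ->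
  n_comp e predT = (n_comp e' predT + ~~ connect e x y)%N.
Proof.
move=> sym_e De'.
have sym_e' : symmetric e'.
  move=> u v; rewrite !De' sym_e; congr (_ || _).
  by rewrite orbC andbC [X in _ || X]andbC.
have ce := sym_connect_sym sym_e; have ce' := sym_connect_sym sym_e'.
have sub_ee' : subrel (connect e) (connect e').
  by apply: connect_sub => u v euv; apply: connect1; rewrite De' euv.
pose a : pred T := closure e (pred2 x y).
have ax : x \in a by apply: mem_closure; rewrite !inE eqxx.
have ay : y \in a by apply: mem_closure; rewrite !inE eqxx orbT.
have cl_a : closed e a by apply: closure_closed.
have cl_a' : closed e' a.
  apply: (intro_closed ce') => u v; rewrite De'.
  by case/or3P => [/cl_a ->|/andP[/eqP-> /eqP->]|/andP[/eqP-> /eqP->]].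
have -> : n_comp e predT = n_comp e T by apply: eq_n_comp_r.
have -> : n_comp e' predT = n_comp e' T by apply: eq_n_comp_r.
rewrite (n_compC a e) (n_compC a e') n_comp_closure2 //.
have -> : n_comp e' a = 1.
  rewrite (eq_n_comp_r (a' := closure e' (pred2 x y))).
    rewrite n_comp_closure2 // connect1 // De' !eqxx orbT //.
  move=> u; apply/idP/idP.
    case/pred0Pn => v /andP[/= euv xyv]; apply/pred0Pn; exists v.
    by rewrite /= [_ \in _]sub_ee'.
  case/pred0Pn => v /andP[/= euv xyv].
  by rewrite (closed_connect cl_a' euv); case/pred2P: xyv => ->.
have -> : n_comp e [predC a] = n_comp e' [predC a].
  apply: eq_card => u; rewrite !inE; case: (boolP (u \in a)) => [|nau].
    by rewrite !andbF.
  rewrite !andbT /roots /root; congr (odflt _ _ == _); apply: eq_pick => v /=.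
  apply/idP/idP => [/sub_ee' //|/connectP[s]].
  (* A path of [e'] that starts outside [a] stays outside [a], which contains [x] and [y], so it
     never uses the new edge. *)
  elim: s u nau => [|w s IHs] u nau /=; first by move=> _ ->; apply: connect0.
  case/andP => euw pws Dv.
  have naw : w \notin a by rewrite -(cl_a' _ _ euw).
  apply: connect_trans (IHs _ naw pws Dv); apply: connect1.
  move: euw; rewrite De'; case/or3P => // /andP[/eqP Du _]; move: nau.
    by rewrite Du ax.
  by rewrite Du ay.
by rewrite addSn add1n addSn addnC.
Qed.

Local Open Scope ring_scope.

(** * Averaged update operators and the coupon-collector process *)

Section Average.

Variables (R : realFieldType) (I : finType) (D : {set I}).

Definition average (X : Type) (K : I -> (X -> R) -> X -> R) (h : X -> R) (x : X) :=
  #|D|%:R^-1 * \sum_(e in D) K e h x.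

(** [S] plays the role of an invariant set of states: an update at a point of [S] only has to
    respect inequalities between values on [S]. *)
Lemma iter_average_le (X : Type) (K : I -> (X -> R) -> X -> R) (S : X -> Prop) :
  (forall e h h' x, e \in D -> (forall y, S y -> h y <= h' y) -> S x ->
     K e h x <= K e h' x) ->
  forall t h h', (forall x, S x -> h x <= h' x) ->
  forall x, S x -> iter t (average K) h x <= iter t (average K) h' x.
Proof.
move=> K_le; elim=> [|t IHt] h h' le_hh' x Sx /=; first exact: le_hh'.
rewrite /average ler_wpM2l ?invr_ge0 ?ler0n //.
by apply: ler_sum => e eD; apply: K_le => // y Sy; apply: IHt.
Qed.

(** A lumping criterion, used to identify the marginals of the coupling. *)
Lemma iter_average_map (X Y : Type) (K : I -> (X -> R) -> X -> R)
    (L : I -> (Y -> R) -> Y -> R) (f : X -> Y) :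
  (forall e h x, K e (h \o f) x = L e h (f x)) ->
  forall t h x, iter t (average K) (h \o f) x = iter t (average L) h (f x).
Proof.
move=> KL; elim=> [//|t IHt] h x /=; rewrite /average; congr (_ * _).
by apply: eq_bigr => e _; rewrite -KL; congr (K e _ x); apply: funext.
Qed.

Lemma iter_average_lin (X : Type) (K : I -> (X -> R) -> X -> R) :
  (forall e a b h h' x,
     K e (fun y => a * h y + b * h' y) x = a * K e h x + b * K e h' x) ->
  forall t a b h h' x, iter t (average K) (fun y => a * h y + b * h' y) x
    = a * iter t (average K) h x + b * iter t (average K) h' x.
Proof.
move=> Klin; elim=> [//|t IHt] a b h h' x /=; rewrite /average.
rewrite (funext (IHt a b h h')).
under eq_bigr do rewrite Klin.
by rewrite big_split /= -!mulr_sumr; ring.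
Qed.

Lemma iter_average_cst (X : Type) (K : I -> (X -> R) -> X -> R) (c : R) :
  (0 < #|D|)%N -> (forall e x, K e (fun=> c) x = c) ->
  forall t x, iter t (average K) (fun=> c) x = c.
Proof.
move=> D_gt0 Kc; elim=> [//|t IHt] x /=; rewrite /average.
rewrite (funext IHt); under eq_bigr do rewrite Kc.
by rewrite sumr_const -[c *+ _]mulr_natl mulKf // pnatr_eq0 -lt0n.
Qed.

(** Dual update of the coupon collector: [W] holds the elements not drawn so far. *)
Definition forget (e : I) (h : {set I} -> R) (W : {set I}) := h (W :\ e).

Lemma average_forget_card (h : nat -> R) (W : {set I}) :
  W \subset D -> (0 < #|D|)%N ->
  average forget (fun U => h #|U|) W =
    (1 - #|W|%:R / #|D|%:R) * h #|W| + #|W|%:R / #|D|%:R * h #|W|.-1.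
Proof.
move=> sWD D_gt0; rewrite /average /forget.
have D_neq0 : #|D|%:R != 0 :> R by rewrite pnatr_eq0 -lt0n.
rewrite (bigID (mem W)) /= (eq_bigr (fun=> h #|W|.-1)); last first.
  by move=> e /andP[_ eW]; rewrite [in RHS](cardsD1 e W) eW.
rewrite [X in _ + X](eq_bigr (fun=> h #|W|)); last first.
  by move=> e /andP[_ eW]; rewrite [in RHS](cardsD1 e W) (negbTE eW).
have -> : \sum_(i in D | i \in W) h #|W|.-1 = #|W|%:R * h #|W|.-1.
  rewrite (eq_bigl (mem W)) => [|i]; last by rewrite andb_idl //; apply/subsetP.
  by rewrite sumr_const -[_ *+ _]mulr_natl.
have -> : \sum_(i in D | i \notin W) h #|W| = (#|D|%:R - #|W|%:R) * h #|W|.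
  rewrite (eq_bigl (mem (D :\: W))) => [|i]; last by rewrite !inE andbC.
  by rewrite sumr_const -[_ *+ _]mulr_natl cardsDS // natrB ?subset_leq_card.
by field.
Qed.

(* Factorial moments of the number of elements of W that were never drawn. *)
Lemma iter_forget_moments (t : nat) (c2 c1 c0 : R) (W : {set I}) :
  W \subset D -> (0 < #|D|)%N ->
  iter t (average forget)
    (fun U => c2 * (#|U|%:R * (#|U|%:R - 1)) + c1 * #|U|%:R + c0) W =
  c2 * (1 - 2 / #|D|%:R) ^+ t * (#|W|%:R * (#|W|%:R - 1))
    + c1 * (1 - #|D|%:R^-1) ^+ t * #|W|%:R + c0.
Proof.
move=> sWD D_gt0; have D_neq0 : #|D|%:R != 0 :> R by rewrite pnatr_eq0 -lt0n.
elim: t c2 c1 => [|t IHt] c2 c1; first by rewrite /= !expr0 !mulr1.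
(* The innermost operator is applied first: with [u = #|U|], the polynomials [u(u - 1)] and [u] are
   eigenfunctions, of eigenvalues [1 - 2/|D|] and [1 - 1/|D|]. *)
rewrite iterSr.
set b2 := c2 * (1 - 2 / #|D|%:R); set b1 := c1 * (1 - #|D|%:R^-1).
transitivity (iter t (average forget)
    (fun U => b2 * (#|U|%:R * (#|U|%:R - 1)) + b1 * #|U|%:R + c0) W); last first.
  by rewrite IHt !exprS /b2 /b1 !mulrA.
have step (U : {set I}) : U \subset D -> average forget
    (fun U => c2 * (#|U|%:R * (#|U|%:R - 1)) + c1 * #|U|%:R + c0) U =
    b2 * (#|U|%:R * (#|U|%:R - 1)) + b1 * #|U|%:R + c0.
  move=> sUD; rewrite (average_forget_card
    (fun k => c2 * (k%:R * (k%:R - 1)) + c1 * k%:R + c0)) // /b2 /b1.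
  by case: #|U| => [|k]; rewrite /= -?natr1; field.
(* The one-step identity is established only on subsets of [D], so it passes through the iteration
   as two inequalities with that invariant. *)
apply: le_anti; apply/andP; split.
all: apply: (iter_average_le (S := fun U : {set I} => U \subset D)) => //.
all: try by move=> e h h' x eD hh' sx; apply: hh'; apply: subset_trans sx; apply: subsetDl.
all: by move=> x sx; rewrite step.
Qed.

(** Second-moment method. [M] is the mean number of survivors; distinct elements survive with
    nonpositive correlation, so the variance is at most [M], and [M >= 4s] gives
    [M / (M - 2s)^2 <= 1/s]. *)
Lemma forget_chebyshev (t : nat) (s : R) (W : {set I}) :
  W \subset D -> (1 < #|D|)%N -> 0 < s ->
  4 * s <= #|W|%:R * (1 - #|D|%:R^-1) ^+ t ->
  iter t (average forget) (fun U => (#|U|%:R <= 2 * s)%R%:R) W <= s^-1.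
Proof.
move=> sWD D_gt1 s_gt0 le_s; set M := #|W|%:R * _ in le_s.
have D_gt0 : (0 < #|D|)%N by apply: ltnW.
have D_ge2 : 2 <= #|D|%:R :> R by rewrite ler_nat.
have D_pos : 0 < #|D|%:R :> R by rewrite ltr0n.
pose c := (M - 2 * s) ^- 2.
have Ms : 0 < M - 2 * s by lra.
have c_gt0 : 0 < c by rewrite invr_gt0 exprn_gt0.
(* The indicator is dominated by [(M - u)^2 / (M - 2s)^2], expanded in the factorial polynomials
   whose iterates are known. *)
apply: (@le_trans _ _ (iter t (average forget) (fun U =>
  c * (#|U|%:R * (#|U|%:R - 1)) + (c * (1 - 2 * M)) * #|U|%:R + c * M ^+ 2) W)).
  apply: (iter_average_le (S := fun U : {set I} => U \subset D)) => //.
    by move=> e h h' x eD hh' sx; apply: hh'; apply: subset_trans sx; apply: subsetDl.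
  move=> U sUD; set u := #|U|%:R.
  have -> : c * (u * (u - 1)) + c * (1 - 2 * M) * u + c * M ^+ 2 = c * (M - u) ^+ 2.
    by ring.
  case: (leP u (2 * s)) => [le_u|_] /=; last by rewrite mulr0n mulr_ge0 ?sqr_ge0 // ltW.
  rewrite -[1%:R](mulVf (x := (M - 2 * s) ^+ 2)) ?expf_neq0 ?gt_eqF //.
  by rewrite ler_wpM2l ?(ltW c_gt0) // lerXn2r ?nnegrE; lra.
rewrite iter_forget_moments //.
have le_b : (1 - 2 / #|D|%:R) ^+ t <= ((1 - #|D|%:R^-1) ^+ t) ^+ 2 :> R.
  rewrite -exprM mulnC exprM lerXn2r ?nnegrE ?sqr_ge0 //.
    by rewrite subr_ge0 ler_pdivrMr // mul1r.
  have -> : (1 - #|D|%:R^-1) ^+ 2 = 1 - 2 / #|D|%:R + #|D|%:R^-1 ^+ 2 :> R by ring.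
  by rewrite lerDl sqr_ge0.
set b := (1 - 2 / _) ^+ t in le_b *; set a := (1 - _) ^+ t in M le_s Ms c c_gt0 le_b *.
have W_ge : #|W|%:R * (#|W|%:R - 1) <= #|W|%:R ^+ 2 :> R by have := ler0n R #|W|; nra.
have W_ge0 : 0 <= #|W|%:R * (#|W|%:R - 1) :> R.
  by case: #|W| => [|k]; rewrite ?mul0r // -natr1 addrK mulr_ge0 ?addr_ge0 ?ler0n ?ler01.
have : b * (#|W|%:R * (#|W|%:R - 1)) <= M ^+ 2.
  apply: (@le_trans _ _ (a ^+ 2 * (#|W|%:R * (#|W|%:R - 1)))).
    by rewrite ler_wpM2r.
  by rewrite /M exprMn mulrC ler_wpM2r ?sqr_ge0.
set z := #|W|%:R * (#|W|%:R - 1) => le_bz.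
have -> : c * b * z + c * (1 - 2 * M) * a * #|W|%:R + c * M ^+ 2
    = c * (b * z + M - M ^+ 2) by rewrite /M; ring.
apply: (@le_trans _ _ (c * M)); first by rewrite ler_wpM2l ?(ltW c_gt0) //; lra.
rewrite /c -(ler_pM2l (x := (M - 2 * s) ^+ 2 * s)); last by rewrite mulr_gt0 ?exprn_gt0.
have -> : (M - 2 * s) ^+ 2 * s * s^-1 = (M - 2 * s) ^+ 2 by rewrite mulfK ?gt_eqF.
have -> : (M - 2 * s) ^+ 2 * s * ((M - 2 * s) ^- 2 * M) = s * M.
  by field; rewrite gt_eqF.
nra.
Qed.

End Average.

(** * Reversible monotone heat-bath dynamics on the subsets of a finite set *)

Section HeatBath.

Variables (R : realFieldType) (I : finType) (D : {set I}).
Variables (r : {set I} -> I -> R) (p : R) (mu : {set I} -> R).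

Implicit Types (A B : {set I}) (e : I) (f g h : {set I} -> R).

Hypothesis D_gt1 : (1 < #|D|)%N.
Hypothesis p_lt1 : p < 1.
Hypothesis r_ge0 : forall A e, A \subset D -> e \in D -> 0 <= r A e.
Hypothesis r_le : forall A e, A \subset D -> e \in D -> r A e <= p.
Hypothesis r_setU1 : forall A e, A \subset D -> e \in D -> r (A :|: [set e]) e = r A e.
Hypothesis r_setD1 : forall A e, A \subset D -> e \in D -> r (A :\ e) e = r A e.
Hypothesis r_mono : forall A B e,
  A \subset B -> B \subset D -> e \in D -> r A e <= r B e.
Hypothesis mu_ge0 : forall A, A \subset D -> 0 <= mu A.
Hypothesis mu_sum : \sum_(A in powerset D) mu A = 1.
Hypothesis mu_balance : forall A e, A \subset D -> e \in D ->
  mu (A :|: [set e]) * (1 - r A e) = mu (A :\ e) * r A e.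

Let D_gt0 : (0 < #|D|)%N. Proof. exact: ltnW. Qed.
Let D_pos : 0 < #|D|%:R :> R. Proof. by rewrite ltr0n. Qed.

Let r_lt1 A e : A \subset D -> e \in D -> r A e < 1.
Proof. by move=> sAD eD; apply: le_lt_trans (r_le sAD eD) _. Qed.

Lemma subset_setU1 A e : A \subset D -> e \in D -> A :|: [set e] \subset D.
Proof. by move=> sAD eD; rewrite subUset sAD sub1set. Qed.

Lemma subset_setD1 A e : A \subset D -> A :\ e \subset D.
Proof. by apply: subset_trans; apply: subsetDl. Qed.

Definition heat_bath e h A :=
  r A e * h (A :|: [set e]) + (1 - r A e) * h (A :\ e).

Local Notation glauber_op := (average D heat_bath).

Definition expect h := \sum_(A in powerset D) mu A * h A.
Definition dot f h := expect (fun A => f A * h A).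

Lemma expect_le f h : (forall A, A \subset D -> f A <= h A) -> expect f <= expect h.
Proof.
move=> le_fh; apply: ler_sum => A; rewrite powersetE => sAD.
by rewrite ler_wpM2l ?mu_ge0 // le_fh.
Qed.

Lemma eq_expect f h : (forall A, A \subset D -> f A = h A) -> expect f = expect h.
Proof. by move=> eq_fh; apply: eq_bigr => A; rewrite powersetE => /eq_fh ->. Qed.

Lemma expect_cst c : expect (fun=> c) = c.
Proof. by rewrite /expect -mulr_suml mu_sum mul1r. Qed.

Lemma expect_lin a b f h :
  expect (fun A => a * f A + b * h A) = a * expect f + b * expect h.
Proof.
rewrite /expect !mulr_sumr -big_split /=; apply: eq_bigr => A _; ring.
Qed.

Lemma heat_bath_lin e a b f h A :
  heat_bath e (fun B => a * f B + b * h B) A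
    = a * heat_bath e f A + b * heat_bath e h A.
Proof. rewrite /heat_bath; ring. Qed.

Lemma heat_bath_cst c e A : heat_bath e (fun=> c) A = c.
Proof. rewrite /heat_bath; ring. Qed.

Lemma heat_bath_le e f h A : e \in D -> (forall B, B \subset D -> f B <= h B) ->
  A \subset D -> heat_bath e f A <= heat_bath e h A.
Proof.
move=> eD le_fh sAD; rewrite /heat_bath lerD //.
  by rewrite ler_wpM2l ?r_ge0 // le_fh ?subset_setU1.
by rewrite ler_wpM2l ?subr_ge0 ?(ltW (r_lt1 sAD eD)) // le_fh ?subset_setD1.
Qed.

Lemma iter_glauber_le t f h : (forall A, A \subset D -> f A <= h A) ->
  forall A, A \subset D -> iter t glauber_op f A <= iter t glauber_op h A.
Proof.
apply: (iter_average_le (S := fun A => A \subset D)) => e f' h' A eD le_fh sAD.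
exact: heat_bath_le.
Qed.

Lemma iter_glauber_cst t c A : iter t glauber_op (fun=> c) A = c.
Proof. by apply: iter_average_cst => // e B; apply: heat_bath_cst. Qed.

Lemma iter_glauber_lin t a b f h A :
  iter t glauber_op (fun B => a * f B + b * h B) A
    = a * iter t glauber_op f A + b * iter t glauber_op h A.
Proof. exact: iter_average_lin heat_bath_lin _ _ _ _ _ _. Qed.

(** [r A e] ignores the state of [e], so [heat_bath e] is the conditional expectation given the
    configuration off [e]. *)
Lemma heat_bath_idem e h A : e \in D -> A \subset D ->
  heat_bath e (heat_bath e h) A = heat_bath e h A.
Proof.
move=> eD sAD; rewrite {1}/heat_bath {1 2}/heat_bath r_setU1 // r_setD1 //.
have -> : (A :|: [set e]) :\ e = A :\ e by rewrite setDUl setDv setU0.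
have -> : (A :\ e) :|: [set e] = A :|: [set e] by apply/setP => i; rewrite !inE; case: (i == e); rewrite ?orbT ?orbF.
by rewrite -setUA setUid setDDl setUid /heat_bath; ring.
Qed.

Lemma sum_powerset_pair e (F : {set I} -> R) : e \in D ->
  \sum_(A in powerset D) F A =
    \sum_(A in powerset D | e \notin A) (F (A :|: [set e]) + F A).
Proof.
move=> eD; rewrite big_split /= (bigID (fun A => e \in A)) /=; congr (_ + _).
rewrite (reindex_onto (fun A => A :|: [set e]) (fun A => A :\ e)) /=; last first.
  move=> A /andP[_ eA]; apply/setP => i; rewrite !inE.
  by case: eqP => [->|]; rewrite ?orbT ?orbF.
apply: eq_bigl => A; rewrite !powersetE subUset sub1set eD andbT !inE eqxx orbT andbT.
congr (_ && _); apply/eqP/idP => [<-|neA]; first by rewrite !inE eqxx.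
by apply/setP => i; rewrite !inE; case: eqP => [->|]; rewrite ?orbF // (negbTE neA).
Qed.

(** On each pair formed by [A] and [A :|: [set e]] the two sides differ by a multiple of the
    detailed-balance defect. *)
Lemma heat_bath_adjoint e f h : e \in D ->
  dot f (heat_bath e h) = dot (heat_bath e f) h.
Proof.
move=> eD; rewrite /dot /expect 2!(sum_powerset_pair _ eD).
apply: eq_bigr => A /andP[]; rewrite powersetE => sAD neA.
have := mu_balance sAD eD; rewrite /heat_bath r_setU1 //.
have -> : A :\ e = A by apply/setDidPl; rewrite disjoint_sym disjoints1.
have -> : (A :|: [set e]) :\ e = A.
  by rewrite setDUl setDv setU0; apply/setDidPl; rewrite disjoint_sym disjoints1.
rewrite -setUA setUid => bal.
set a := mu _ in bal *; set b := mu A in bal *; set z := r A e in bal *.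
apply/eqP; rewrite -subr_eq0; apply/eqP.
transitivity ((a * (1 - z) - b * z) * (f (A :|: [set e]) * h A - h (A :|: [set e]) * f A)).
  by ring.
by rewrite bal subrr mul0r.
Qed.

Lemma dot_glauber f h :
  dot f (glauber_op h) = #|D|%:R^-1 * \sum_(e in D) dot f (heat_bath e h).
Proof.
rewrite /dot /expect exchange_big mulr_sumr; apply: eq_bigr => A _.
by rewrite /average -!mulr_sumr; ring.
Qed.

Lemma dotC f h : dot f h = dot h f.
Proof. by apply: eq_expect => A _; rewrite mulrC. Qed.

Lemma glauber_adjoint f h : dot f (glauber_op h) = dot (glauber_op f) h.
Proof.
rewrite [RHS]dotC !dot_glauber; congr (_ * _); apply: eq_bigr => e eD.
by rewrite heat_bath_adjoint // dotC.
Qed.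

Lemma iter_glauber_adjoint t f h :
  dot f (iter t glauber_op h) = dot (iter t glauber_op f) h.
Proof. by elim: t f => [//|t IHt] f; rewrite iterS glauber_adjoint IHt -iterSr. Qed.

Lemma dot_ge0 f : 0 <= dot f f.
Proof. by rewrite -(expect_cst 0); apply: expect_le => A _; rewrite -expr2 sqr_ge0. Qed.

(** Each [heat_bath e] is a self-adjoint projection, so its quadratic form is a squared norm. *)
Lemma dot_glauber_ge0 f : 0 <= dot f (glauber_op f).
Proof.
rewrite dot_glauber mulr_ge0 ?invr_ge0 ?ler0n //; apply: sumr_ge0 => e eD.
have -> : dot f (heat_bath e f) = dot (heat_bath e f) (heat_bath e f).
  rewrite -[RHS]heat_bath_adjoint //.
  by apply: eq_expect => A sAD; rewrite heat_bath_idem.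
exact: dot_ge0.
Qed.

Lemma dot_iter_ge0 t f : 0 <= dot f (iter t glauber_op f).
Proof.
(* Self-adjointness moves half of the iterations to the left; one operator remains when [t] is
   odd. *)
rewrite -(odd_double_half t) -addnn addnA addnC iterD iter_glauber_adjoint.
by case: (odd t); rewrite ?add1n ?add0n ?iterS; [apply: dot_glauber_ge0 | apply: dot_ge0].
Qed.

Lemma expect_glauber t h : expect (iter t glauber_op h) = expect h.
Proof.
have := iter_glauber_adjoint t (fun=> 1) h; rewrite /dot => adj.
transitivity (expect (fun A => 1 * iter t glauber_op h A)).
  by apply: eq_expect => A _; rewrite mul1r.
by rewrite adj; apply: eq_expect => A _; rewrite iter_glauber_cst mul1r.
Qed.

Lemma dot_lin_l a b f f' h :
  dot (fun A => a * f A + b * f' A) h = a * dot f h + b * dot f' h.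
Proof.
rewrite /dot -expect_lin; apply: eq_expect => A _; ring.
Qed.

Lemma dot_lin_r a b f h h' :
  dot f (fun A => a * h A + b * h' A) = a * dot f h + b * dot f h'.
Proof. by rewrite dotC dot_lin_l ![dot _ f]dotC. Qed.

(* Positivity of the heat-bath operator makes the autocorrelations convex in time. *)
Lemma autocorrelation_convex t g :
  dot g (iter t.+1 glauber_op g) - dot g (iter t.+2 glauber_op g)
    <= dot g (iter t glauber_op g) - dot g (iter t.+1 glauber_op g).
Proof.
(* With [P] the chain operator and [u = g - P g], the number [<u, P^t u>] is the second difference
   of the autocorrelations. *)
pose u A := 1 * g A + -1 * glauber_op g A.
have := dot_iter_ge0 t u.
rewrite /u (funext (iter_glauber_lin t 1 (-1) g (glauber_op g))).
rewrite dot_lin_r !dot_lin_l -!iterSr -!glauber_adjoint -!iterS.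
lra.
Qed.

(** By convexity no later drop exceeds the first one; the [t] drops telescope. *)
Lemma autocorrelation_decay t g :
  dot g g - dot g (iter t glauber_op g) <= t%:R * (dot g g - dot g (glauber_op g)).
Proof.
have inc s : dot g (iter s glauber_op g) - dot g (iter s.+1 glauber_op g)
    <= dot g g - dot g (glauber_op g).
  by elim: s => [//|s IHs]; apply: le_trans (autocorrelation_convex s g) IHs.
elim: t => [|t IHt]; first by rewrite mul0r subrr.
by rewrite -natr1 mulrDl mul1r; have := inc t; lra.
Qed.

(** The left side is the average over [e] of the mean square of [g - heat_bath e g]. An update at
    [e] changes the cardinality by at most one, so this difference is at most one in absolute
    value. *)
Lemma dirichlet_card c (g := fun A => #|A|%:R - c) :
  dot g g - dot g (glauber_op g) <= 1.
Proof.
have -> : dot g g - dot g (glauber_op g) =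
    #|D|%:R^-1 * \sum_(e in D) (dot g g - dot g (heat_bath e g)).
  rewrite sumrB mulrBr -dot_glauber sumr_const -[dot g g *+ _]mulr_natl mulKf //.
  by rewrite gt_eqF.
rewrite mulrC ler_pdivrMr // mul1r -[leRHS]sumr_const; apply: ler_sum => e eD.
have -> : dot g g - dot g (heat_bath e g) =
    expect (fun A => (g A - heat_bath e g A) ^+ 2).
  have idem : dot (heat_bath e g) (heat_bath e g) = dot g (heat_bath e g).
    rewrite -[LHS]heat_bath_adjoint //.
    by apply: eq_expect => A sAD; rewrite heat_bath_idem.
  transitivity (dot (fun A => 1 * g A + -1 * heat_bath e g A)
                    (fun A => 1 * g A + -1 * heat_bath e g A)).
    by rewrite dot_lin_l !dot_lin_r idem [dot (heat_bath e g) g]dotC; ring.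
  by apply: eq_expect => A _; ring.
rewrite -[leRHS]expect_cst; apply: expect_le => A sAD.
have r0 := r_ge0 sAD eD; have r1 := r_lt1 sAD eD.
have leU : #|A|%:R <= #|A :|: [set e]|%:R :> R by rewrite ler_nat subset_leq_card ?subsetUl.
have leU1 : #|A :|: [set e]|%:R <= #|A|%:R + 1 :> R.
  by rewrite natr1 ler_nat -addn1 -(cards1 e) cardsU leq_subr.
have leD : #|A :\ e|%:R <= #|A|%:R :> R by rewrite ler_nat subset_leq_card ?subsetDl.
have leD1 : #|A|%:R <= #|A :\ e|%:R + 1 :> R.
  by rewrite natr1 ler_nat (cardsD1 e A) -add1n leq_add2r leq_b1.
rewrite /g /heat_bath.
set a := #|A|%:R in leU leU1 leD leD1 *.
set b := #|A :|: _|%:R in leU leU1 *; set d := #|A :\ e|%:R in leD leD1 *.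
set z := r A e in r0 r1 *.
have -> : a - c - (z * (b - c) + (1 - z) * (d - c)) = (1 - z) * (a - d) - z * (b - a).
  by ring.
have lo : -1 <= (1 - z) * (a - d) - z * (b - a) by nra.
have hi : (1 - z) * (a - d) - z * (b - a) <= 1 by nra.
by move: lo hi; set y := _ - z * _ => lo hi; nra.
Qed.

(** By invariance of [mu] under the update at [e], after which [e] is present with probability
    [r A e <= p]. *)
Lemma expect_mem_le e : e \in D -> expect (fun A => (e \in A)%:R) <= p.
Proof.
move=> eD; have := heat_bath_adjoint (fun=> 1) (fun A => (e \in A)%:R) eD.
rewrite /dot => adj.
have -> : expect (fun A => (e \in A)%:R) =
    expect (fun A => 1 * heat_bath e (fun A => (e \in A)%:R) A).
  by rewrite adj; apply: eq_expect => A _; rewrite heat_bath_cst mul1r.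
rewrite -[leRHS]expect_cst; apply: expect_le => A sAD.
by rewrite /heat_bath !inE eqxx orbT mulr1 mulr0 addr0 mul1r r_le.
Qed.

Definition mean_card : R := expect (fun A => #|A|%:R).

Definition var_card : R := expect (fun A => (#|A|%:R - mean_card) ^+ 2).

Lemma mean_card_le : mean_card <= p * #|D|%:R.
Proof.
have -> : mean_card = \sum_(e in D) expect (fun A => (e \in A)%:R).
  rewrite /mean_card /expect exchange_big; apply: eq_bigr => A.
  rewrite powersetE => sAD; rewrite -mulr_sumr; congr (_ * _).
  rewrite -natr_sum -sum1_card big_mkcond [in RHS]big_mkcond /=; congr _%:R.
  apply: eq_bigr => i _; case: ifPn => [/(subsetP sAD) -> //|_].
  by rewrite if_same.
rewrite mulrC mulr_natl -sumr_const; apply: ler_sum => e eD.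
exact: expect_mem_le.
Qed.

Lemma card_bounds A : A \subset D -> 0 <= (#|A|%:R : R) <= #|D|%:R.
Proof. by move=> sAD; rewrite ler0n ler_nat subset_leq_card. Qed.

Lemma mean_card_bounds : 0 <= mean_card <= #|D|%:R.
Proof.
rewrite -[X in X <= _ <= _]expect_cst -[X in _ <= _ <= X]expect_cst.
by apply/andP; split; apply: expect_le => A /card_bounds/andP[].
Qed.

(** * Variance bound under mixing from every start *)

Section Mixed.

Variable T : nat.

Hypothesis mixed : forall A h a b, A \subset D ->
  (forall B, B \subset D -> a <= h B <= b) ->
  `|iter T glauber_op h A - expect h| <= (b - a) / 4.

(** The hypothesis [mixed] is the dual form of distance at most [1/4]. After [T] steps the values
    lie within a quarter of the range on either side of the unchanged mean, so each round halves the
    range. *)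
Lemma mixed_contraction k A h a b : A \subset D ->
  (forall B, B \subset D -> a <= h B <= b) ->
  `|iter (k * T) glauber_op h A - expect h| <= (b - a) / 2 ^+ k.
Proof.
move=> sAD; elim: k h a b => [|k IHk] h a b h_ab.
  rewrite expr0 divr1 /=; have /andP[ha hb] := h_ab A sAD.
  have Ea : a <= expect h by rewrite -(expect_cst a); apply: expect_le => B /h_ab/andP[].
  have Eb : expect h <= b by rewrite -(expect_cst b); apply: expect_le => B /h_ab/andP[].
  by rewrite ler_norml; lra.
rewrite mulSn addnC iterD -(expect_glauber T h).
apply: le_trans (IHk _ (expect h - (b - a) / 4) (expect h + (b - a) / 4) _) _.
  by move=> B sBD; have := mixed sBD h_ab; rewrite ler_norml; lra.
have -> : expect h + (b - a) / 4 - (expect h - (b - a) / 4) = (b - a) / 2 by field.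
by rewrite exprS invfM mulrA.
Qed.

(** The variance splits into the autocorrelation lost over [k T] steps, at most one per step, and
    the rest, at most [|D|] times the contracted oscillation. *)
Lemma var_card_le k : var_card <= (k * T)%:R + #|D|%:R ^+ 2 / 2 ^+ k.
Proof.
pose g A : R := #|A|%:R - mean_card.
have /andP[E0 Em] := mean_card_bounds.
have -> : var_card = dot g g by apply: eq_expect => A _; rewrite expr2.
have := autocorrelation_decay (k * T) g.
have := dirichlet_card mean_card; rewrite -/g => dir dec.
have dec1 : dot g g - dot g (iter (k * T) glauber_op g) <= (k * T)%:R.
  by apply: le_trans dec _; rewrite ler_piMr ?ler0n.
suff : dot g (iter (k * T) glauber_op g) <= #|D|%:R ^+ 2 / 2 ^+ k by lra.
have Eg : expect g = 0.
  transitivity (expect (fun A => 1 * #|A|%:R + -1 * mean_card)).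
    by apply: eq_expect => A _; rewrite /g; ring.
  by rewrite expect_lin expect_cst -/mean_card; ring.
rewrite -[leRHS]expect_cst; apply: expect_le => A sAD.
have := mixed_contraction k (h := g) (a := - mean_card)
  (b := #|D|%:R - mean_card) sAD.
rewrite Eg subr0 opprK subrK => /(_ _) Hg.
apply: le_trans (ler_norm _) _; rewrite normrM expr2 -mulrA ler_pM //.
  by have := card_bounds sAD; rewrite /g ler_norml; lra.
by apply: Hg => B /card_bounds; rewrite /g; lra.
Qed.

End Mixed.

(** * Monotone coupling and the contradiction with mixing *)

Definition coupled_update e (F : {set I} * {set I} * {set I} -> R)
    (x : {set I} * {set I} * {set I}) :=
  let: (X, Y, W) := x in
  r Y e * F (X :|: [set e], Y :|: [set e], W :\ e)
    + (r X e - r Y e) * F (X :|: [set e], Y :\ e, W :\ e)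
    + (1 - r X e) * F (X :\ e, Y :\ e, W :\ e).

Definition coupled (x : {set I} * {set I} * {set I}) :=
  let: (X, Y, W) := x in [&& X \subset D, Y \subset X, W \subset X & [disjoint W & Y]].

(** One uniform variable drives both copies: below [r Y e] both gain [e], between [r Y e] and
    [r X e] only [X] does, above that neither. [r_mono] makes the middle weight nonnegative, and
    each outcome is again a coupled triple. *)
Lemma coupled_update_le e F G x : e \in D ->
  (forall y, coupled y -> F y <= G y) -> coupled x ->
  coupled_update e F x <= coupled_update e G x.
Proof.
case: x => [[X Y] W] eD le_FG /and4P[sXD sYX sWX dWY].
have sub2 : W :\ e \subset X :\ e by apply: setSD.
have sub1 : Y :\ e \subset X :\ e by apply: setSD.
have subX : X :\ e \subset X :|: [set e] by apply: subset_trans (subsetUl _ _); apply: subsetDl.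
have dD : [disjoint W :\ e & Y :\ e].
  apply: disjointWl (subsetDl _ _) _; apply: disjointWr (subsetDl _ _) dWY.
rewrite /coupled_update !lerD //.
- rewrite ler_wpM2l ?r_ge0 ?(subset_trans sYX) // le_FG //=.
  rewrite subset_setU1 // setSU // (subset_trans sub2) //=.
  rewrite disjoint_subset; apply/subsetP => i; rewrite !inE => /andP[ne iW].
  by rewrite negb_or ne (disjointFr dWY iW).
- by rewrite ler_wpM2l ?subr_ge0 ?r_mono // le_FG //= subset_setU1 // !(subset_trans _ subX).
- by rewrite ler_wpM2l ?subr_ge0 ?(ltW (r_lt1 sXD eD)) // le_FG //= subset_setD1 // sub1 sub2.
Qed.

(* W collects the elements outside Y that no update has touched yet: they are
   still in X and still not in Y. *)
Lemma monotone_coupling t (a s : R) B : B \subset D ->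
  iter t glauber_op (fun A => (#|A|%:R <= a + s)%R%:R) D <=
    iter t glauber_op (fun A => (#|A|%:R <= a - s)%R%:R) B +
    iter t (average D (@forget R I)) (fun U => (#|U|%:R <= 2 * s)%R%:R) (D :\: B).
Proof.
move=> sBD; pose x := (D, B, D :\: B).
pose f A : R := (#|A|%:R <= a + s)%R%:R; pose g A : R := (#|A|%:R <= a - s)%R%:R.
pose w A : R := (#|A|%:R <= 2 * s)%R%:R.
rewrite -/f -/g -/w.
pose piX (x : {set I} * {set I} * {set I}) := x.1.1.
pose piY (x : {set I} * {set I} * {set I}) := x.1.2.
pose piW (x : {set I} * {set I} * {set I}) := x.2.
(* The coordinates of the coupled process have as marginals two copies of the dynamics and the
   coupon collector. *)
have -> : iter t glauber_op f D = iter t (average D coupled_update) (f \o piX) x.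
  rewrite (iter_average_map D (L := heat_bath)) // => e h [[X Y] W].
  rewrite /coupled_update /heat_bath /=; ring.
have -> : iter t glauber_op g B = iter t (average D coupled_update) (g \o piY) x.
  rewrite (iter_average_map D (L := heat_bath)) // => e h [[X Y] W].
  rewrite /coupled_update /heat_bath /=; ring.
have -> : iter t (average D (@forget R I)) w (D :\: B)
    = iter t (average D coupled_update) (w \o piW) x.
  rewrite (iter_average_map D (L := @forget R I)) // => e h [[X Y] W].
  rewrite /coupled_update /forget /=; ring.
rewrite -[X in _ <= X + _]mul1r -[X in _ <= _ + X]mul1r -iter_average_lin; last first.
  move=> e a' b' h h' [[X Y] W]; rewrite /coupled_update; ring.
apply: (iter_average_le (S := coupled)); first exact: coupled_update_le.
  case=> [[X Y] W] /and4P[sXD sYX sWX dWY]; rewrite /f /g /w /= !mul1r.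
  (* As [|X| >= |Y| + |W|], the event [|X| <= a + s] forces [|Y| <= a - s] or [|W| <= 2s]. *)
  have le_card : #|Y|%:R + #|W|%:R <= #|X|%:R :> R.
    rewrite -natrD ler_nat -[leqLHS]subn0 -(cards0 I).
    have <- : Y :&: W = set0 by apply/disjoint_setI0; rewrite disjoint_sym.
    by rewrite -cardsU subset_leq_card // subUset sYX.
  case: (leP #|X|%:R (a + s)) => [leX|_] /=; last by rewrite addr_ge0 ?ler0n.
  case: (leP #|Y|%:R (a - s)) => [leY|ltY] /=; first by rewrite lerDl ler0n.
  by case: (leP #|W|%:R (2 * s)) => [leW|ltW] /=; [rewrite lerDr ler0n | lra].
rewrite /x /= subxx sBD subsetDl /=.
by rewrite disjoint_sym disjoints_subset setCD subsetUr.
Qed.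

(** By Chebyshev the event [|A| <= E + s] has stationary probability at least [1 - v/s^2], while
    from the full set it has probability at most [2v/s^2 + 1/s] at time [T]; mixing allows a gap of
    only [1/4]. *)
Lemma not_mixed (T : nat) (s v : R) :
  (forall A h a b, A \subset D -> (forall B, B \subset D -> a <= h B <= b) ->
     `|iter T glauber_op h A - expect h| <= (b - a) / 4) ->
  var_card <= v -> 0 < s ->
  4 * s <= ((1 - p) * #|D|%:R - s) * (1 - #|D|%:R^-1) ^+ T ->
  3 / 4 <= 3 * (v / s ^+ 2) + s^-1.
Proof.
move=> mixed le_v s_gt0 le_s.
have s2 : 0 < s ^+ 2 by rewrite exprn_gt0.
pose E := mean_card.
pose g A : R := (#|A|%:R - E) ^+ 2 / s ^+ 2.
have g_ge0 A : 0 <= g A by rewrite divr_ge0 ?sqr_ge0.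
have Eg : expect g <= v / s ^+ 2.
  rewrite ler_pdivlMr //; apply: le_trans le_v; rewrite le_eqVlt; apply/orP; left.
  rewrite mulrC /expect mulr_sumr; apply/eqP; apply: eq_bigr => A _.
  by rewrite /g /E; field; rewrite gt_eqF.
have g_ge1 A : s <= `|#|A|%:R - E| -> 1 <= g A.
  move=> le_g; rewrite /g ler_pdivlMr // mul1r -[leRHS]real_normK ?num_real //.
  by rewrite lerXn2r ?nnegrE ?(ltW s_gt0) ?normr_ge0.
pose h1 A : R := (#|A|%:R <= E + s)%R%:R; pose h2 A : R := (#|A|%:R <= E - s)%R%:R.
have Eh1 : 1 - v / s ^+ 2 <= expect h1.
  apply: (@le_trans _ _ (expect (fun A => 1 * 1 + -1 * g A))).
    by rewrite expect_lin expect_cst; lra.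
  apply: expect_le => A _; rewrite /h1; case: (leP #|A|%:R (E + s)) => [_|lt] /=.
    by have := g_ge0 A; rewrite mulr1n; lra.
  have : 1 <= g A by apply: g_ge1; rewrite ler_normr; lra.
  by rewrite mulr0n; lra.
have Eh2 : expect h2 <= v / s ^+ 2.
  apply: le_trans Eg; apply: expect_le => A _; rewrite /h2; case: (leP #|A|%:R (E - s)) => [le|lt] //=.
  by rewrite mulr1n; apply: g_ge1; rewrite ler_normr; lra.
have h01 (b : bool) : 0 <= (b%:R : R) <= 1 by case: b; rewrite ?lexx ?ler01.
have mD := mixed D h1 0 1 (subxx D) (fun B _ => h01 _).
pose forgotten B := iter T (average D (@forget R I))
  (fun U => (#|U|%:R <= 2 * s)%R%:R) (D :\: B).
have le_forgotten B : B \subset D -> forgotten B <= s^-1 + g B.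
  (* If [|B|] is at least [s] away from the mean, [g B >= 1] covers the trivial bound; otherwise at
     least [(1 - p)|D| - s] elements are outside [B]. *)
  move=> sBD; have := g_ge0 B; case: (leP (s ) `|#|B|%:R - E|) => [/g_ge1 gB _|ltB gB].
    have : forgotten B <= 1.
      rewrite -[leRHS](@iter_average_cst R I D _ (@forget R I) 1 D_gt0 _ T (D :\: B)) //.
      apply: (iter_average_le (S := fun=> True)) => //.
        by move=> e h h' U _ hh' _; apply: hh'.
      by move=> U _; have /andP[] := h01 (#|U|%:R <= 2 * s)%R.
    have : 0 < s^-1 by rewrite invr_gt0.
    by lra.
  suff : forgotten B <= s^-1 by lra.
  apply: forget_chebyshev => //; first exact: subsetDl.
  apply: le_trans le_s _; apply: ler_wpM2r.
    rewrite exprn_ge0 // subr_ge0 invf_le1 // ler1n //.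
  rewrite cardsDS // natrB ?subset_leq_card //.
  by have := mean_card_le; move: ltB; rewrite -/E ltr_norml; lra.
have : iter T glauber_op h1 D <=
    expect (fun B => 1 * iter T glauber_op h2 B + 1 * (1 * s^-1 + 1 * g B)).
  (* The left side does not depend on [B], so the coupling bound is averaged over a stationary
     [B]. *)
  rewrite -[leLHS]expect_cst; apply: expect_le => B sBD.
  apply: le_trans (monotone_coupling T E s sBD) _.
  by have := le_forgotten B sBD; rewrite /forgotten -/h2; lra.
rewrite expect_lin expect_glauber expect_lin expect_cst.
by move: mD; rewrite ler_norml; lra.
Qed.

(** The mixing time may depend on the start. A common time [T] is reached by replacing [h] with its
    iterate over the remaining [T - t] steps, which keeps its bounds and its mean. *)
Lemma early_mixing_bound (T k : nat) (s : R) :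
  (forall A, A \subset D -> exists2 t, (t <= T)%N & forall h a b,
     (forall B, B \subset D -> a <= h B <= b) ->
     `|iter t glauber_op h A - expect h| <= (b - a) / 4) ->
  0 < s -> 4 * s <= ((1 - p) * #|D|%:R - s) * (1 - #|D|%:R^-1) ^+ T ->
  3 / 4 <= 3 * (((k * T)%:R + #|D|%:R ^+ 2 / 2 ^+ k) / s ^+ 2) + s^-1.
Proof.
move=> early s_gt0 le_s.
have mixed A h a b : A \subset D -> (forall B, B \subset D -> a <= h B <= b) ->
    `|iter T glauber_op h A - expect h| <= (b - a) / 4.
  move=> sAD h_ab; have [t le_tT mix_t] := early A sAD.
  rewrite -(subnKC le_tT) iterD -(expect_glauber (T - t) h).
  apply: mix_t => B sBD; apply/andP; split.
    rewrite -(iter_glauber_cst (T - t) a B).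
    by apply: iter_glauber_le => // C /h_ab/andP[].
  rewrite -(iter_glauber_cst (T - t) b B).
  by apply: iter_glauber_le => // C /h_ab/andP[].
exact: not_mixed mixed (var_card_le mixed k) s_gt0 le_s.
Qed.

End HeatBath.

Local Notation R := Rdefinitions.R.

(** * The random-cluster measure as an instance of the abstract dynamics *)

Section RandomCluster.

Variables (n : nat) (p q : R) (eta : {set {set V n}}).
Hypotheses (p_gt0 : 0 < p) (p_lt1 : p < 1) (q_ge1 : 1 <= q).

Implicit Types (A B C : {set V n * V n}) (e : V n * V n).

Let q_gt0 : 0 < q. Proof. exact: lt_le_trans ltr01 q_ge1. Qed.
Let np_gt0 : 0 < 1 - p. Proof. by rewrite subr_gt0. Qed.

Lemma ncomp_setD1 A e :
  ncomp (A :\ e) eta =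
    (ncomp (A :|: [set e]) eta + ~~ connect (clrel (A :\ e) eta) e.1 e.2)%N.
Proof.
apply: n_comp_add_edge => [u v|u v].
  rewrite /clrel orbCA; congr [|| _, _ | _].
  by apply: eq_existsb => B; rewrite [(u \in B) && _]andbC.
rewrite /clrel !inE.
have E1 : ((u, v) == e) = (u == e.1) && (v == e.2) by rewrite {1}[e]surjective_pairing xpair_eqE.
have E2 : ((v, u) == e) = (v == e.1) && (u == e.2) by rewrite {1}[e]surjective_pairing xpair_eqE.
rewrite -E1 [(u == e.2) && _]andbC -E2.
by case: (_ == e); case: (_ == e); rewrite ?orbT ?orbF //= ?orbT.
Qed.

Lemma rc_weightE A :
  rc_weight p q eta A = p ^+ #|A| * (1 - p) ^+ (#|E n| - #|A|) * q ^+ ncomp A eta.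
Proof. by rewrite /rc_weight !RpowE. Qed.

Lemma rc_weight_gt0 A : 0 < rc_weight p q eta A.
Proof. by rewrite rc_weightE !mulr_gt0 ?exprn_gt0. Qed.

Lemma rc_Z_gt0 : 0 < rc_Z p q eta.
Proof.
rewrite -[rc_Z _ _ _]/(\sum_(A in powerset (E n)) rc_weight p q eta A).
rewrite (bigD1 set0) /=; last by rewrite powersetE sub0set.
rewrite ltr_pwDl ?rc_weight_gt0 //; apply: sumr_ge0 => A _.
exact: ltW (rc_weight_gt0 A).
Qed.

Lemma rc_muE A : rc_mu p q eta A = rc_weight p q eta A / rc_Z p q eta.
Proof. exact: RdivE. Qed.

Lemma rc_mu_gt0 A : 0 < rc_mu p q eta A.
Proof. by rewrite rc_muE divr_gt0 ?rc_weight_gt0 ?rc_Z_gt0. Qed.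

Lemma rc_mu_sum : \sum_(A in powerset (E n)) rc_mu p q eta A = 1.
Proof.
under eq_bigr do rewrite rc_muE.
by rewrite -mulr_suml divff // gt_eqF ?rc_Z_gt0.
Qed.

Lemma open_prob_rc_mu A e : open_prob p q eta A e =
  rc_mu p q eta (A :|: [set e]) / (rc_mu p q eta (A :|: [set e]) + rc_mu p q eta (A :\ e)).
Proof. exact: RdivE. Qed.

(** The common factors of the two weights cancel; what remains is [p] if the endpoints are already
    connected off [e], and [p / (p + (1 - p) q)] if not. *)
Lemma open_probE A e : A \subset E n -> e \in E n ->
  open_prob p q eta A e =
    p / (p + (1 - p) * q ^+ (~~ connect (clrel (A :\ e) eta) e.1 e.2)).
Proof.
move=> sAE eE; rewrite open_prob_rc_mu !rc_muE !rc_weightE ncomp_setD1.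
have Z0 := rc_Z_gt0; set Z := rc_Z _ _ _ in Z0 *.
set k := ncomp (A :|: [set e]) eta; set b := (~~ _ : nat).
have -> : #|A :|: [set e]| = #|A :\ e|.+1.
  by rewrite setUC (cardsD1 e) !inE eqxx -add1n; congr (_ + #|pred_of_set _|)%N;
     apply/setP => i; rewrite !inE; case: eqP.
have lt_c : (#|A :\ e| < #|E n|)%N.
  have <- : #|e |: A :\ e| = #|A :\ e|.+1 by rewrite cardsU1 !inE eqxx.
  by rewrite subset_leq_card // subUset sub1set eE (subset_trans (subsetDl _ _)).
set c := #|A :\ e| in lt_c *; rewrite -(subnSK lt_c) !exprS exprD.
have p0 : p ^+ c != 0 by rewrite expf_neq0 ?gt_eqF.
have p1 : (1 - p) ^+ (#|E n| - c.+1) != 0 by rewrite expf_neq0 ?gt_eqF.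
have q0 : q ^+ k != 0 by rewrite expf_neq0 ?gt_eqF.
have den : 0 < p + (1 - p) * q ^+ b by rewrite addr_gt0 ?mulr_gt0 ?exprn_gt0.
set x := p ^+ c in p0 *; set y := _ ^+ _ in p1 *; set z := q ^+ k in q0 *.
set w := q ^+ b in den *.
have xyz : x * y * z / Z != 0 by rewrite !mulf_neq0 ?invr_eq0 // gt_eqF.
have -> : p * x * y * z / Z + x * ((1 - p) * y) * (z * w) / Z =
   x * y * z / Z * (p + (1 - p) * w) by ring.
have -> : p * x * y * z / Z = x * y * z / Z * p by ring.
by rewrite -mulf_div divff // mul1r.
Qed.

Lemma open_prob_ge0 A e : 0 <= open_prob p q eta A e.
Proof.
by rewrite open_prob_rc_mu divr_ge0 // ?addr_ge0 // ltW ?rc_mu_gt0.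
Qed.

Lemma open_prob_le A e : A \subset E n -> e \in E n -> open_prob p q eta A e <= p.
Proof.
move=> sAE eE; rewrite open_probE //; case: connect => /=.
  by rewrite expr0 mulr1 addrC subrK divr1.
rewrite expr1 ler_pdivrMr; last by rewrite addr_gt0 ?mulr_gt0.
rewrite ler_peMr ?(ltW p_gt0) //.
have -> : p + (1 - p) * q = 1 + (1 - p) * (q - 1) by ring.
by rewrite lerDl mulr_ge0 ?(ltW np_gt0) // subr_ge0.
Qed.

(** Connection off [e] is increasing in the configuration, and for [q >= 1] it can only raise the
    opening probability. *)
Lemma open_prob_mono A B e : A \subset B -> B \subset E n -> e \in E n ->
  open_prob p q eta A e <= open_prob p q eta B e.
Proof.
move=> sAB sBE eE; have sAE := subset_trans sAB sBE; rewrite !open_probE //.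
have mono : connect (clrel (A :\ e) eta) e.1 e.2 -> connect (clrel (B :\ e) eta) e.1 e.2.
  apply: connect_sub => u v; rewrite /clrel => /or3P uv; apply: connect1.
  have sAB' := subsetP (setSD [set e] sAB).
  by case: uv => [/sAB'->|/sAB'->|->]; rewrite ?orbT.
case: connect mono => [-> //|_]; case: connect => //=.
rewrite expr0 expr1 mulr1 ler_wpM2l ?(ltW p_gt0) // lef_pV2 ?posrE.
- by rewrite lerD2l ler_peMr // (ltW np_gt0).
- by rewrite addr_gt0 ?mulr_gt0.
- by rewrite addr_gt0.
Qed.

Lemma rc_balance A e :
  rc_mu p q eta (A :|: [set e]) * (1 - open_prob p q eta A e) =
  rc_mu p q eta (A :\ e) * open_prob p q eta A e.
Proof.
rewrite open_prob_rc_mu.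
move: (rc_mu_gt0 (A :|: [set e])) (rc_mu_gt0 (A :\ e)).
move: (rc_mu _ _ _ (A :|: [set e])) (rc_mu _ _ _ (A :\ e)) => a b a0 b0.
by field; rewrite gt_eqF ?addr_gt0.
Qed.

Lemma open_prob_setU1 A e : open_prob p q eta (A :|: [set e]) e = open_prob p q eta A e.
Proof. by rewrite /open_prob -setUA setUid setDUl setDv setU0. Qed.

Lemma open_prob_setD1 A e : open_prob p q eta (A :\ e) e = open_prob p q eta A e.
Proof.
rewrite !open_prob_rc_mu setDDl setUid.
have -> // : A :\ e :|: [set e] = A :|: [set e].
by apply/setP => i; rewrite !inE; case: (i == e); rewrite ?orbT ?orbF.
Qed.

Local Notation glauber_op := (average (E n) (heat_bath (open_prob p q eta))).

Lemma sum_if_eq C (o : R) (h : {set V n * V n} -> R) : C \subset E n ->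
  \sum_(B in powerset (E n)) (if B == C then o else 0) * h B = o * h C.
Proof.
move=> sCE; rewrite (bigD1 C) /= ?powersetE // eqxx big1 ?addr0 // => B /andP[_ /negbTE ->].
by rewrite mul0r.
Qed.

Lemma sum_glauber A (h : {set V n * V n} -> R) : A \subset E n ->
  \sum_(B in powerset (E n)) glauber p q eta A B * h B = glauber_op h A.
Proof.
move=> sAE; rewrite /average.
transitivity (\sum_(B in powerset (E n)) #|E n|%:R^-1 * (\sum_(e in E n)
   ((if B == A :|: [set e] then open_prob p q eta A e else 0) * h B +
    (if B == A :\ e then 1 - open_prob p q eta A e else 0) * h B))).
  apply: eq_bigr => B _; rewrite /glauber INRE RmultE RinvE -mulrA; congr (_ * _).
  rewrite mulr_suml; apply: eq_bigr => e _; exact: mulrDl.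
rewrite -mulr_sumr exchange_big; congr (_ * _); apply: eq_bigr => e eE.
rewrite big_split /= !sum_if_eq // ?(subset_trans (subsetDl _ _)) //.
by rewrite subUset sAE sub1set.
Qed.

Lemma sum_distr (X0 : {set V n * V n}) t (h : {set V n * V n} -> R) : X0 \subset E n ->
  \sum_(B in powerset (E n)) distr p q eta X0 t B * h B = iter t glauber_op h X0.
Proof.
move=> sX0; elim: t h => [|t IHt] h; first by rewrite /= sum_if_eq // mul1r.
rewrite iterSr -IHt /=.
transitivity (\sum_(B in powerset (E n)) \sum_(A in powerset (E n))
  distr p q eta X0 t A * glauber p q eta A B * h B).
  by apply: eq_bigr => B _; rewrite -mulr_suml.
rewrite exchange_big; apply: eq_bigr => A; rewrite powersetE => sAE.
by rewrite -sum_glauber // mulr_sumr; apply: eq_bigr => B _; rewrite mulrA.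
Qed.

(** Both laws have total mass one, so [h] may be recentred at [(a + b) / 2], where it is bounded by
    [(b - a) / 2]; the factor [1/2] is the one in [tv]. *)
Lemma tv_test (X0 : {set V n * V n}) t (h : {set V n * V n} -> R) (a b : R) : (1 < #|E n|)%N ->
  X0 \subset E n -> (forall B, B \subset E n -> a <= h B <= b) ->
  `|iter t glauber_op h X0 - expect (E n) (rc_mu p q eta) h| <=
    tv (distr p q eta X0 t) (rc_mu p q eta) * (b - a).
Proof.
move=> E_gt1 sX0 h_ab; pose d := distr p q eta X0 t; pose mu := rc_mu p q eta.
have mu_sum : \sum_(B in powerset (E n)) mu B = 1 := rc_mu_sum.
have d_sum : \sum_(B in powerset (E n)) d B = 1.
  transitivity (\sum_(B in powerset (E n)) d B * 1).
    by apply: eq_bigr => B _; rewrite mulr1.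
  by rewrite sum_distr // iter_glauber_cst.
have -> : iter t glauber_op h X0 - expect (E n) mu h =
    \sum_(B in powerset (E n)) (d B - mu B) * (h B - (a + b) / 2).
  rewrite -sum_distr // /expect -/d.
  under [RHS]eq_bigr do rewrite mulrBr !mulrBl.
  by rewrite !sumrB -2!mulr_suml d_sum mu_sum; ring.
have -> : tv d mu * (b - a) =
    \sum_(B in powerset (E n)) `|d B - mu B| * ((b - a) / 2).
  rewrite -mulr_suml /tv RmultE RinvE.
  under eq_bigr do rewrite RabsE RminusE.
  rewrite -[bigop.body _ _ _]/(\sum_(B in powerset (E n)) `|d B - mu B|).
  by ring.
apply: le_trans (ler_norm_sum _ _ _) _; apply: ler_sum => B.
rewrite powersetE normrM => /h_ab hB; rewrite ler_wpM2l //.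
by rewrite ler_norml; lra.
Qed.

Lemma tau_mix_geW (T0 : R) (T k : nat) (s : R) : (1 < #|E n|)%N ->
  T0 <= T%:R -> 0 < s ->
  4 * s <= ((1 - p) * #|E n|%:R - s) * (1 - #|E n|%:R^-1) ^+ T ->
  3 * (((k * T)%:R + #|E n|%:R ^+ 2 / 2 ^+ k) / s ^+ 2) + s^-1 < 3 / 4 ->
  tau_mix_ge p q eta T0.
Proof.
move=> E_gt1 T0T s_gt0 le_s lt34; apply: contrapT => notge.
suff : 3 / 4 <= 3 * (((k * T)%:R + #|E n|%:R ^+ 2 / 2 ^+ k) / s ^+ 2) + s^-1.
  by rewrite leNgt lt34.
have r_ge0 A e : A \subset E n -> e \in E n -> 0 <= open_prob p q eta A e.
  by move=> _ _; apply: open_prob_ge0.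
have r_U A e : A \subset E n -> e \in E n ->
    open_prob p q eta (A :|: [set e]) e = open_prob p q eta A e.
  by move=> _ _; apply: open_prob_setU1.
have r_D A e : A \subset E n -> e \in E n ->
    open_prob p q eta (A :\ e) e = open_prob p q eta A e.
  by move=> _ _; apply: open_prob_setD1.
have mu_ge0 A : A \subset E n -> 0 <= rc_mu p q eta A.
  by move=> _; apply: ltW; apply: rc_mu_gt0.
have bal A e : A \subset E n -> e \in E n ->
    rc_mu p q eta (A :|: [set e]) * (1 - open_prob p q eta A e) =
    rc_mu p q eta (A :\ e) * open_prob p q eta A e.
  by move=> _ _; apply: rc_balance.
apply: (early_mixing_bound E_gt1 p_lt1 r_ge0 open_prob_le r_U r_D open_prob_mono
  mu_ge0 rc_mu_sum bal k _ s_gt0 le_s).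
move=> A sAE.
have [t [ltt tvt]] : exists t : nat, t%:R < T0 /\
    tv (distr p q eta A t) (rc_mu p q eta) <= 4^-1.
  apply: contrapT => nex; apply: notge; exists A; split=> // t ltt.
  apply/RltP; rewrite RinvE ltNge; apply/negP => le4; apply: nex; exists t.
  split; first by rewrite -INRE; apply/RltP.
  apply: le_trans le4 _; rewrite le_eqVlt; apply/orP; left; apply/eqP.
  by rewrite IZRposE INRE.
exists t.
  by rewrite -(ler_nat R); apply: le_trans T0T; apply: ltW.
move=> h a b h_ab; apply: le_trans (tv_test t E_gt1 sAE h_ab) _.
rewrite mulrC ler_wpM2l // subr_ge0.
by have /andP[ha hb] := h_ab A sAE; apply: le_trans hb.
Qed.

End RandomCluster.

(** * Edge count and choice of constants *)

Lemma card_E_ge (n : nat) : (n * n.-1 <= #|E n|)%N.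
Proof.
case: n => [//|k] /=.
(* Only the edges along the second coordinate are counted, which already gives order [n^2]. *)
pose f (x : 'I_k.+1 * 'I_k) : V k.+1 * V k.+1 :=
  ((x.1, widen_ord (leqnSn k) x.2), (x.1, lift ord0 x.2)).
have f_inj : injective f.
  by move=> [i j] [i' j'] [-> /ord_inj ->].
have -> : (k.+1 * k = #|f @: [set: 'I_k.+1 * 'I_k]|)%N.
  by rewrite card_imset // cardsT card_prod !card_ord.
apply/subset_leq_card/subsetP => _ /imsetP[x _ ->].
by rewrite inE /adj /= eqxx /bump /= add1n eqxx.
Qed.

Local Close Scope ring_scope.
Local Open Scope R_scope.

Theorem theorem6p1 (p q : R) :
  1 <= q -> 0 < p -> p < sqrt q / (sqrt q + 1) ->
  exists c : R, 0 < c /\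
    exists N : nat, forall n : nat, (N <= n)%N ->
      forall eta : {set {set V n}}, side_homogeneous eta ->
        tau_mix_ge p q eta (c * (INR n ^ 2) * ln (INR n)).
Proof.
move=> q1 p0 pq.
have p1 : p < 1.
  apply: Rlt_trans pq _; apply: (Rmult_lt_reg_r (sqrt q + 1)).
    by have := sqrt_pos q; Lra.lra.
  by rewrite /Rdiv Rmult_assoc Rinv_l; have := sqrt_pos q; Lra.lra.
have [M [M4 window]] := window_exists p0 p1.
have [N0 [N0M _]] : exists N0 : nat, M <= INR N0 <= M + 1 by apply: nat_ceiling; Lra.lra.
(* Half of the [1/16] allowed by [window]: for [n >= 2] the number [m] of edges satisfies
   [n^2 <= 2 n (n - 1) <= 2 m], and [ln n <= ln m]. *)
exists (/ 32); split; first Lra.lra.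
exists (maxn N0 2) => n; rewrite geq_max => /andP[leN n2] eta _.
have n2R : 2 <= INR n by apply: (le_INR 2); apply/ssrnat.leP.
have leNR : INR N0 <= INR n by apply: le_INR; apply/ssrnat.leP.
have mn : INR n * (INR n - 1) <= INR #|E n|.
  have -> : INR n - 1 = INR n.-1 by rewrite -{1}(prednK (ltnW n2)) S_INR; Lra.lra.
  by rewrite -mult_INR; apply: le_INR; apply/ssrnat.leP/card_E_ge.
have mn1 : INR n <= INR #|E n| by Lra.nra.
have ln_n : 0 <= ln (INR n) by rewrite -ln_1; apply: ln_le_compat; Lra.lra.
have ln_m : ln (INR n) <= ln (INR #|E n|) by apply: ln_le_compat; Lra.lra.
have [|T [T1 T2]] := @nat_ceiling (/ 32 * INR n ^ 2 * ln (INR n)).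
  by apply: Rmult_le_pos => //; simpl; Lra.nra.
have [||k [s [s0 [le_s lt34]]]] := window #|E n| T.
- Lra.lra.
- apply: Rle_trans T2 _; apply: Rplus_le_compat_r.
  have : INR n ^ 2 * ln (INR n) <= 2 * INR #|E n| * ln (INR #|E n|).
    rewrite [INR n ^ 2]/= Rmult_1_r; apply: Rmult_le_compat => //; Lra.nra.
  by Lra.lra.
have IZR_nat j : IZR (Z.pos j) = (ssrnat.nat_of_pos j)%:R%R by rewrite IZRposE INRE.
have IZR2 := IZR_nat 2%positive; have IZR3 := IZR_nat 3%positive.
have IZR4 := IZR_nat 4%positive.
apply: (@tau_mix_geW n p q eta _ _ _ _ T k s).
- exact/RltP.
- exact/RltP.
- exact/RleP.
- have : (INR 1 < INR #|E n|) by rewrite [INR 1]/=; Lra.lra.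
  by move/INR_lt/ssrnat.ltP.
- by rewrite -INRE; apply/RleP.
- exact/RltP.
- by rewrite -IZR4 -!INRE -RpowE; apply/RleP.
- by rewrite -IZR2 -IZR3 -IZR4 natrM -!INRE -!RpowE; apply/RltP.
Qed.
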